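(* Let $k$ be a number field with ring of integers $\mathcal{O}$, $I\subset k$ a fractional $\mathcal{O}$-ideal, $\mathfrak{D}$ the absolute different of $k$, $\hat I=\mathfrak{D}^{-1}I^{-1}$, and $\mathfrak{f}$ a non-zero proper ideal of $\mathcal{O}$ with $\mathfrak{f}\cap\mathbb{Z}=f\mathbb{Z}$. Put $A=I/\mathfrak{f}I$ and $B=\mathfrak{f}^{-1}\hat I/\hat I$ (modules over $\mathcal{O}/\mathfrak{f}$), and define $\delta:(A\oplus B)\times(A\oplus B)\to f^{-1}\mathbb{Z}/\mathbb{Z}$ by $\delta((\bar a,\bar b)^T,(\bar a',\bar b')^T)=\mathrm{Tr}_{k/\mathbb{Q}}(ab'-a'b)+\mathbb{Z}$. Let $\bar x$ be an $\mathcal{O}/\mathfrak{f}$-basis of $A$ and $\bar y$ an $\mathcal{O}/\mathfrak{f}$-basis of $B$ (such free generators exist), and let $\Xi^\times:\mathrm{Aut}_{\mathcal{O}/\mathfrak{f}}(A\oplus B)\to\mathrm{GL}_2(\mathcal{O}/\mathfrak{f})$ be the isomorphism sending $\bar\phi$ to the matrix $\begin{pmatrix}u&v\\ w&z\end{pmatrix}$ where $\bar\phi((\bar x,0)^T)=(u\bar x,w\bar y)^T$ and $\bar\phi((0,\bar y)^T)=(v\bar x,z\bar y)^T$. Then $\Xi^\times$ restricts to an isomorphism from $\mathrm{Sp}_{\mathcal{O}/\mathfrak{f}}(A\oplus B;\delta)$ onto $\mathrm{SL}_2(\mathcal{O}/\mathfrak{f})$.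
   Context: The pairing $\delta$ is well defined by standard properties of the different. $\mathrm{Sp}_{\mathcal{O}/\mathfrak{f}}(A\oplus B;\delta)$ denotes the group of $\mathcal{O}/\mathfrak{f}$-linear automorphisms $\alpha$ of $A\oplus B$ satisfying $\delta(\alpha\mathbf{x},\alpha\mathbf{x}')=\delta(\mathbf{x},\mathbf{x}')$ for all $\mathbf{x},\mathbf{x}'\in A\oplus B$. Elements of $A\oplus B$ are written as column vectors. *)

(* Defs.v *)
From HB Require Import structures.
From mathcomp Require Import all_boot all_order all_algebra all_field.
From mathcomp Require Import boolp classical_sets.

Set Implicit Arguments.
Unset Strict Implicit.
Unset Printing Implicit Defensive.

Import GRing.Theory.

Local Open Scope ring_scope.
Local Open Scope quotient_scope.

(* Throughout, number fields are inhabitants of fieldExtType rat. *)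

Section RingOfIntegers.
Variable k : fieldExtType rat.

Definition integral : {pred k} :=
  fun x => `[< integralOver (intr : int -> k) x >].

Arguments integral : clear implicits.

Lemma integral_subring_closed : subring_closed integral.
Proof.
split=> [|x y /asboolP ix /asboolP iy|x y /asboolP ix /asboolP iy].
- exact/asboolP/integral1.
- exact/asboolP/integral_sub.
- exact/asboolP/integral_mul.
Qed.

HB.instance Definition _ :=
  GRing.isSubringClosed.Build k integral integral_subring_closed.

Record ringint := Ringint { ringint_val :> k; _ : ringint_val \in integral }.

HB.instance Definition _ := [isSub for ringint_val].
HB.instance Definition _ := [Choice of ringint by <:].
HB.instance Definition _ := [SubChoice_isSubComNzRing of ringint by <:].

Definition trace (a : k) : rat :=
  \tr (passmx.mxof (vbasis {:k}) (vbasis {:k}) (amull a)).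

End RingOfIntegers.

Arguments integral k : clear implicits.

(* Here O is the ring of integers of k; an osubmod is an O-submodule of k,
   seen as a boolean predicate on k by means of classical logic. *)

HB.mixin Record isIntegralStable (k : fieldExtType rat) (S : k -> bool) := {
  integral_stable : forall a x : k, a \in integral k -> S x -> S (a * x)
}.

#[short(type="osubmod")]
HB.structure Definition OSubmod (k : fieldExtType rat) :=
  {S of GRing.ZmodClosed k S & isIntegralStable k S}.

Definition fractional_ideal (k : fieldExtType rat) (I : osubmod k) : Prop :=
  (exists2 x, x \in I & x != 0) /\
  (exists2 d, d \in integral k & d != 0 /\
     forall x, x \in I -> d * x \in integral k).

Section IdealOperations.
Variable k : fieldExtType rat.
Implicit Types (M N : osubmod k) (F : idealr (ringint k)).

Definition prod_ideal M N : {pred k} := fun z =>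
  `[< exists s : seq (k * k),
        all (fun p => (p.1 \in M) && (p.2 \in N)) s /\
        z = \sum_(p <- s) p.1 * p.2 >].

Fact prod_ideal_zmod M N : zmod_closed (prod_ideal M N).
Proof.
split=> [|x y /asboolP[s [sP ->]] /asboolP[t [tP ->]]]; apply/asboolP.
  by exists [::]; rewrite big_nil.
exists (s ++ [seq (- p.1, p.2) | p <- t]); rewrite all_cat sP big_cat big_map.
split; last by rewrite -sumrN; congr (_ + _); apply: eq_bigr => p _; rewrite mulNr.
by rewrite all_map; apply: sub_all tP => p /= /andP[p1 p2]; rewrite rpredN p1.
Qed.

HB.instance Definition _ M N :=
  GRing.isZmodClosed.Build k (prod_ideal M N) (prod_ideal_zmod M N).

Fact prod_ideal_stable M N a x :
  a \in integral k -> prod_ideal M N x -> prod_ideal M N (a * x).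
Proof.
move=> aO /asboolP[s [sP ->]]; apply/asboolP.
exists [seq (a * p.1, p.2) | p <- s]; rewrite big_map mulr_sumr; split.
  rewrite all_map; apply: sub_all sP => p /= /andP[p1 ->].
  by rewrite andbT; apply: integral_stable.
by apply: eq_bigr => p _; rewrite mulrA.
Qed.

HB.instance Definition _ M N :=
  isIntegralStable.Build k (prod_ideal M N) (@prod_ideal_stable M N).

Definition inv_ideal M : {pred k} := fun x =>
  `[< forall y, y \in M -> x * y \in integral k >].

Fact inv_ideal_zmod M : zmod_closed (inv_ideal M).
Proof.
split=> [|x y /asboolP xP /asboolP yP]; apply/asboolP => z zM.
  by rewrite mul0r rpred0.
by rewrite mulrBl rpredB ?xP ?yP.
Qed.

HB.instance Definition _ M :=
  GRing.isZmodClosed.Build k (inv_ideal M) (inv_ideal_zmod M).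

Fact inv_ideal_stable M a x :
  a \in integral k -> inv_ideal M x -> inv_ideal M (a * x).
Proof.
by move=> aO /asboolP xP; apply/asboolP => z zM; rewrite -mulrA rpredM ?xP.
Qed.

HB.instance Definition _ M :=
  isIntegralStable.Build k (inv_ideal M) (@inv_ideal_stable M).

Definition ext_ideal F : {pred k} := fun x =>
  `[< exists2 a : ringint k, a \in F & x = a :> k >].

Fact ext_ideal_zmod F : zmod_closed (ext_ideal F).
Proof.
split=> [|x y /asboolP[a aF ->] /asboolP[b bF ->]]; apply/asboolP.
  by exists 0; rewrite ?rpred0.
by exists (a - b); rewrite ?rpredB.
Qed.

HB.instance Definition _ F :=
  GRing.isZmodClosed.Build k (ext_ideal F) (ext_ideal_zmod F).

Fact ext_ideal_stable F a x :
  a \in integral k -> ext_ideal F x -> ext_ideal F (a * x).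
Proof.
move=> aO /asboolP[b bF ->]; apply/asboolP.
by exists (Ringint aO * b); rewrite ?idealMr.
Qed.

HB.instance Definition _ F :=
  isIntegralStable.Build k (ext_ideal F) (@ext_ideal_stable F).

(* Dedekind's complementary module {x | Tr(x O) is contained in Z}; the absolute
   different is defined as its inverse. *)
Definition codifferent : {pred k} := fun x =>
  `[< forall y, y \in integral k -> trace (x * y) \is a Num.int >].

Fact trace_is_zmod_morphism : zmod_morphism (@trace k).
Proof.
move=> x y; rewrite /trace [amull _]raddfB addrC -scaleN1r /=.
by rewrite passmx.mxof_linear raddfD /= mxtraceZ mulN1r addrC.
Qed.

HB.instance Definition _ :=
  GRing.isZmodMorphism.Build k rat (@trace k) trace_is_zmod_morphism.

Fact codifferent_zmod : zmod_closed codifferent.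
Proof.
split=> [|x y /asboolP xP /asboolP yP]; apply/asboolP => z zO.
  by rewrite mul0r raddf0 rpred0.
by rewrite mulrBl raddfB rpredB ?xP ?yP.
Qed.

HB.instance Definition _ :=
  GRing.isZmodClosed.Build k codifferent codifferent_zmod.

Fact codifferent_stable a x :
  a \in integral k -> codifferent x -> codifferent (a * x).
Proof.
move=> aO /asboolP xP; apply/asboolP => z zO.
by rewrite mulrAC mulrC xP // rpredM.
Qed.

HB.instance Definition _ :=
  isIntegralStable.Build k codifferent codifferent_stable.

Definition different : osubmod k := inv_ideal codifferent.

Definition hat_ideal M : osubmod k :=
  prod_ideal (inv_ideal different) (inv_ideal M).

End IdealOperations.

(* The quotient M / N of subgroups of V. Inclusion of N in M is not required in
   the definition: in general, it is the quotient by the intersection. *)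

Section SubgroupQuotient.
Variables (V : zmodType) (M N : zmodClosed V).

Record subgrp := Subgrp { subgrp_val :> V; _ : subgrp_val \in M }.

HB.instance Definition _ := [isSub for subgrp_val].
HB.instance Definition _ := [Choice of subgrp by <:].
HB.instance Definition _ := [SubChoice_isSubZmodule of subgrp by <:].

Definition subgrp_in : {pred subgrp} := fun x => (x : V) \in N.

Fact subgrp_in_zmod : zmod_closed subgrp_in.
Proof.
by split=> [|x y xN yN]; rewrite unfold_in /= ?rpred0 // rpredB.
Qed.

HB.instance Definition _ :=
  GRing.isZmodClosed.Build subgrp subgrp_in subgrp_in_zmod.

Definition subquot := Quotient.quot subgrp_in.

HB.instance Definition _ := Choice.on subquot.
HB.instance Definition _ := GRing.Zmodule.on subquot.

(* The value is 0, and meaningless, when v is not in M. *)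
Definition qclass (v : V) : subquot := \pi_subquot (insubd (0 : subgrp) v).

Definition qrepr (q : subquot) : V := subgrp_val (repr q).

End SubgroupQuotient.

Section ModuleQuotient.
Variables (k : fieldExtType rat) (F : idealr (ringint k)) (M N : osubmod k).

Definition annihilates : Prop := forall (a : ringint k) x,
  a \in F -> x \in M -> (a : k) * x \in N.

Hypothesis FMN : annihilates.

(* The proof of F M <= N is a parameter of the type, because the O/F-module
   structure depends on it. *)
Definition modquot := let _ := FMN in subquot M N.

HB.instance Definition _ := GRing.Zmodule.on modquot.

Local Notation R := {ideal_quot F}.

Definition sub_scale (a : ringint k) (x : subgrp M) : subgrp M :=
  insubd (0 : subgrp M) ((a : k) * subgrp_val x).

Fact sub_scaleE a x : subgrp_val (sub_scale a x) = (a : k) * subgrp_val x.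
Proof.
rewrite /sub_scale; apply: insubdK; apply: integral_stable; first exact: valP.
exact: valP.
Qed.

Definition modquot_scale (c : R) (q : modquot) : modquot :=
  \pi_(subquot M N) (sub_scale (repr c) (repr (q : subquot M N))).

Fact eq_qpi (x y : subgrp M) : subgrp_val x - subgrp_val y \in N ->
  \pi_(subquot M N) x = \pi_(subquot M N) y.
Proof. by move=> h; apply/eqP; rewrite -Quotient.idealrBE. Qed.

Fact qpi_eq (x y : subgrp M) : \pi_(subquot M N) x = \pi_(subquot M N) y ->
  subgrp_val x - subgrp_val y \in N.
Proof. by move=> h; have /eqP := h; rewrite -Quotient.idealrBE. Qed.

Fact modquot_scale_pi a x :
  modquot_scale (\pi_R a) (\pi_(subquot M N) x) =
  \pi_(subquot M N) (sub_scale a x).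
Proof.
apply: eq_qpi; rewrite !sub_scaleE.
set b := repr _; set y := repr _.
have yx : subgrp_val y - subgrp_val x \in N by apply: qpi_eq; rewrite reprK.
have ba : b - a \in F.
  by rewrite [_ \in _]Quotient.idealrBE reprK.
have -> : (b : k) * subgrp_val y - (a : k) * subgrp_val x =
          (b : k) * (subgrp_val y - subgrp_val x) + ((b - a : ringint k) : k) * subgrp_val x.
  by rewrite /= mulrBr mulrBl addrA subrK.
apply: rpredD; last exact: (FMN _ (valP x)).
by apply: integral_stable => //; exact: valP.
Qed.

Fact modquot_scaleA a b v :
  modquot_scale a (modquot_scale b v) = modquot_scale (a * b) v.
Proof.
rewrite -[a]reprK -[b]reprK -[v]reprK -rmorphM /=.
rewrite (modquot_scale_pi (repr b)) !modquot_scale_pi.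
by apply: eq_qpi; rewrite !sub_scaleE /= mulrA subrr rpred0.
Qed.

Fact modquot_scale1 : left_id 1 modquot_scale.
Proof.
move=> v; rewrite -[v]reprK -(rmorph1 \pi_R) modquot_scale_pi.
by apply: eq_qpi; rewrite !sub_scaleE /= mul1r subrr rpred0.
Qed.

Fact modquot_scaleDr : right_distributive modquot_scale +%R.
Proof.
move=> a u v; rewrite -[a]reprK -[u]reprK -[v]reprK.
rewrite -[X in modquot_scale _ X]raddfD !modquot_scale_pi.
rewrite -[RHS]raddfD /=.
by apply: eq_qpi; rewrite /= !sub_scaleE /= mulrDr subrr rpred0.
Qed.

Fact modquot_scaleDl v : {morph modquot_scale^~ v : a b / a + b}.
Proof.
move=> a b; rewrite -[a]reprK -[b]reprK -[v]reprK.
rewrite -raddfD !modquot_scale_pi -[RHS]raddfD /=.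
by apply: eq_qpi; rewrite /= !sub_scaleE /= mulrDl subrr rpred0.
Qed.

HB.instance Definition _ := GRing.Zmodule_isLmodule.Build R modquot
  modquot_scaleA modquot_scale1 modquot_scaleDr modquot_scaleDl.

End ModuleQuotient.

Section Groups.

Section GL2.
Variable R : comNzRingType.

Definition mx_invertible : {pred 'M[R]_2} := fun M =>
  `[< exists N : 'M[R]_2, M *m N = 1%:M /\ N *m M = 1%:M >].

(* R need not carry an inverse operation, hence not unitmx.                   *)
Record GL2 := MkGL2 { GL2_val :> 'M[R]_2; _ : GL2_val \in mx_invertible }.

HB.instance Definition _ := [isSub for GL2_val].
HB.instance Definition _ := [Choice of GL2 by <:].

Fact GL2_one_subproof : (1%:M : 'M[R]_2) \in mx_invertible.
Proof. by apply/asboolP; exists 1%:M; rewrite mulmx1. Qed.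

Fact GL2_mul_subproof (A B : GL2) : A *m B \in mx_invertible.
Proof.
case: A B => [A /= /asboolP[A' [AA' A'A]]] [B /= /asboolP[B' [BB' B'B]]].
apply/asboolP; exists (B' *m A').
by rewrite -mulmxA (mulmxA B) BB' mul1mx AA' -mulmxA (mulmxA A') A'A mul1mx B'B.
Qed.

Definition GL2_inv_mx (A : GL2) : 'M[R]_2 :=
  xget 0 [set N | (A : 'M_2) *m N = 1%:M /\ N *m A = 1%:M]%classic.

Fact GL2_inv_mxP (A : GL2) :
  (A : 'M_2) *m GL2_inv_mx A = 1%:M /\ GL2_inv_mx A *m A = 1%:M.
Proof.
case: A => A AP; have /asboolP := AP.
exact: (@xgetPex _ 0 [set N | A *m N = 1%:M /\ N *m A = 1%:M]%classic).
Qed.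

Fact GL2_inv_subproof (A : GL2) : GL2_inv_mx A \in mx_invertible.
Proof. by have [? ?] := GL2_inv_mxP A; apply/asboolP; exists A. Qed.

Let one := MkGL2 GL2_one_subproof.
Let mul A B := MkGL2 (GL2_mul_subproof A B).
Let inv A := MkGL2 (GL2_inv_subproof A).

Fact GL2_mulA : associative mul.
Proof. by move=> A B C; apply/val_inj; rewrite /= mulmxA. Qed.
Fact GL2_mul1 : left_id one mul.
Proof. by move=> A; apply/val_inj; rewrite /= mul1mx. Qed.
Fact GL2_mulr1 : right_id one mul.
Proof. by move=> A; apply/val_inj; rewrite /= mulmx1. Qed.
Fact GL2_mulV : left_inverse one inv mul.
Proof. by move=> A; apply/val_inj; have [] := GL2_inv_mxP A. Qed.
Fact GL2_mulVr : right_inverse one inv mul.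
Proof. by move=> A; apply/val_inj; have [] := GL2_inv_mxP A. Qed.

HB.instance Definition _ :=
  isGroup.Build GL2 GL2_mulA GL2_mul1 GL2_mulr1 GL2_mulV GL2_mulVr.

Definition SL2_pred : {pred GL2} := fun A => \det A == 1.

Fact SL2_closed : group_closed SL2_pred.
Proof.
have detM (A B : GL2) : \det (A * B)%g = \det A * \det B := det_mulmx A B.
have detV (A : GL2) : \det A = 1 -> \det (A^-1)%g = 1.
  move=> A1; have := detM A (A^-1)%g.
  by rewrite mulgV A1 mul1r => <-; exact: det1.
split=> [|A B /eqP A1 /eqP B1]; apply/eqP; first exact: det1.
by rewrite detM A1 detV ?mulr1.
Qed.

Record SL2 := MkSL2 { SL2_val :> GL2; _ : SL2_val \in SL2_pred }.

HB.instance Definition _ := [isSub for SL2_val].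
HB.instance Definition _ := [Choice of SL2 by <:].
HB.instance Definition _ := SubChoice_isSubGroup.Build GL2 SL2_pred SL2 SL2_closed.

End GL2.

Section Aut.
Variables (R : nzRingType) (V : lmodType R).

Record Aut := MkAut {
  Aut_val :> V -> V;
  Aut_linear : linear Aut_val;
  Aut_bij : bijective Aut_val }.

HB.instance Definition _ := gen_eqMixin Aut.
HB.instance Definition _ := gen_choiceMixin Aut.
HB.instance Definition _ (phi : Aut) :=
  GRing.isLinear.Build R V V _ phi (Aut_linear phi).

Fact Aut_eqP (phi psi : Aut) : (forall v, phi v = psi v) -> phi = psi.
Proof.
case: phi psi => [f fl fb] [g gl gb] /= /funext fg.
subst g; congr MkAut; exact: Prop_irrelevance.
Qed.

Fact Aut_one_linear : linear (fun v : V => v). Proof. by []. Qed.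
Fact Aut_one_bij : bijective (fun v : V => v). Proof. by exists id. Qed.

Fact Aut_mul_linear (phi psi : Aut) : linear (fun v => phi (psi v)).
Proof. by move=> a u v; rewrite !linearP. Qed.
Fact Aut_mul_bij (phi psi : Aut) : bijective (fun v => phi (psi v)).
Proof. by apply: bij_comp; apply: Aut_bij. Qed.

Definition Aut_inv_fun (phi : Aut) (v : V) : V :=
  xget 0 [set u | phi u = v]%classic.

Fact Aut_inv_funK (phi : Aut) : cancel (Aut_inv_fun phi) phi.
Proof.
move=> v; have [g gK Kg] := Aut_bij phi.
by apply: (@xgetPex _ 0 [set u | phi u = v]%classic); exists (g v).
Qed.
Fact Aut_invK_fun (phi : Aut) : cancel phi (Aut_inv_fun phi).
Proof.
by move=> v; apply: (bij_inj (Aut_bij phi)); rewrite Aut_inv_funK.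
Qed.
Fact Aut_inv_linear (phi : Aut) : linear (Aut_inv_fun phi).
Proof.
move=> a u v; apply: (bij_inj (Aut_bij phi)).
by rewrite Aut_inv_funK Aut_linear !Aut_inv_funK.
Qed.
Fact Aut_inv_bij (phi : Aut) : bijective (Aut_inv_fun phi).
Proof. by exists phi; [exact: Aut_inv_funK | exact: Aut_invK_fun]. Qed.

Let one := MkAut Aut_one_linear Aut_one_bij.
Let mul phi psi := MkAut (Aut_mul_linear phi psi) (Aut_mul_bij phi psi).
Let inv phi := MkAut (@Aut_inv_linear phi) (Aut_inv_bij phi).

Fact Aut_mulA : associative mul. Proof. by move=> *; apply: Aut_eqP. Qed.
Fact Aut_mul1 : left_id one mul. Proof. by move=> *; apply: Aut_eqP. Qed.
Fact Aut_mulr1 : right_id one mul. Proof. by move=> *; apply: Aut_eqP. Qed.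
Fact Aut_mulV : left_inverse one inv mul.
Proof. by move=> phi; apply: Aut_eqP => v; apply: Aut_invK_fun. Qed.
Fact Aut_mulVr : right_inverse one inv mul.
Proof. by move=> phi; apply: Aut_eqP => v; apply: Aut_inv_funK. Qed.

HB.instance Definition _ :=
  isGroup.Build Aut Aut_mulA Aut_mul1 Aut_mulr1 Aut_mulV Aut_mulVr.

Variables (T : Type) (delta : V -> V -> T).

Definition Sp_pred : {pred Aut} := fun alpha =>
  `[< forall x x', delta (alpha x) (alpha x') = delta x x' >].

Fact Sp_closed : group_closed Sp_pred.
Proof.
split=> [|phi psi /asboolP phiP /asboolP psiP]; apply/asboolP => x x' //.
have psiV v : psi ((psi^-1)%g v) = v by exact: Aut_inv_funK.
by rewrite [LHS]phiP -psiP !psiV.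
Qed.

Record Sp := MkSp { Sp_val :> Aut; _ : Sp_val \in Sp_pred }.

HB.instance Definition _ := [isSub for Sp_val].
HB.instance Definition _ := [Choice of Sp by <:].
HB.instance Definition _ := SubChoice_isSubGroup.Build Aut Sp_pred Sp Sp_closed.

End Aut.

End Groups.

(* The family with the single element x is a basis. *)
Definition is_basis (R : nzRingType) (V : lmodType R) (x : V) : Prop :=
  (forall v, exists c : R, v = c *: x) /\ (forall c : R, c *: x = 0 -> c = 0).

Section Xi.
Variables (R : comNzRingType) (A B : lmodType R) (x : A) (y : B).
Hypotheses (x_basis : is_basis x) (y_basis : is_basis y).

Definition coord1 (V : lmodType R) (e v : V) : R :=
  xget 0 [set c | v = c *: e]%classic.

Fact coord1E (V : lmodType R) (e v : V) : is_basis e -> v = coord1 e v *: e.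
Proof. move=> [gen _]; exact: (@xgetPex _ 0 [set c | v = c *: e]%classic (gen v)). Qed.

Fact coord1_unique (V : lmodType R) (e : V) : is_basis e ->
  forall c d : R, c *: e = d *: e -> c = d.
Proof.
move=> [_ free] c d /eqP; rewrite -subr_eq0 -scalerBl => /eqP /free /eqP.
by rewrite subr_eq0 => /eqP.
Qed.

(* The columns are the coordinates of the images of (x, 0) and (0, y). *)
Definition Xi_mx (phi : Aut (A * B)%type) : 'M[R]_2 :=
  \matrix_(i, j)
    let p := if j == 0 then phi (x, 0) else phi (0, y) in
    if i == 0 then coord1 x p.1 else coord1 y p.2.

Lemma Xi_mxE (phi : Aut (A * B)%type) :
  phi (x, 0) = (Xi_mx phi 0 0 *: x, Xi_mx phi 1 0 *: y) /\
  phi (0, y) = (Xi_mx phi 0 1 *: x, Xi_mx phi 1 1 *: y).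
Proof.
by rewrite !mxE /= -!coord1E //; split; case: (phi _).
Qed.

Fact Xi_mx_unique (phi : Aut (A * B)%type) (M : 'M[R]_2) :
  phi (x, 0) = (M 0 0 *: x, M 1 0 *: y) ->
  phi (0, y) = (M 0 1 *: x, M 1 1 *: y) -> Xi_mx phi = M.
Proof.
have [-> ->] := Xi_mxE phi; move=> [e00 e10] [e01 e11].
have ord2 (i : 'I_2) : i = 0 \/ i = 1.
  by case: i => [[|[|//]] i2]; [left | right]; apply: val_inj.
apply/matrixP => i j.
by case: (ord2 i) (ord2 j) => [] -> [] ->;
  first [exact: (coord1_unique x_basis) | exact: (coord1_unique y_basis)].
Qed.

Fact Xi_mxM (phi psi : Aut (A * B)%type) :
  Xi_mx (phi * psi)%g = Xi_mx phi *m Xi_mx psi.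
Proof.
have comb (a b : R) : phi (a *: x, b *: y) =
    ((Xi_mx phi 0 0 * a + Xi_mx phi 0 1 * b) *: x,
     (Xi_mx phi 1 0 * a + Xi_mx phi 1 1 * b) *: y).
  have -> : (a *: x, b *: y) = a *: ((x, 0) : A * B) + b *: ((0, y) : A * B).
    by congr pair; rewrite /= scaler0 ?addr0 ?add0r.
  rewrite linearD !linearZ /=; have [-> ->] := Xi_mxE phi.
  congr pair; rewrite /= !scalerA scalerDl.
    by rewrite (mulrC a) (mulrC b).
  by rewrite (mulrC a) (mulrC b).
have [psi0 psi1] := Xi_mxE psi.
have lift1 : lift ord0 ord0 = 1 :> 'I_2 by apply: val_inj.
apply: Xi_mx_unique; rewrite !mxE !big_ord_recl !big_ord0 !addr0 lift1.
  by rewrite -[LHS]/(phi (psi _)) psi0 comb.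
by rewrite -[LHS]/(phi (psi _)) psi1 comb.
Qed.

Fact Xi_mx1 : Xi_mx 1%g = 1%:M.
Proof.
by apply: Xi_mx_unique; rewrite !mxE /= scale1r scale0r.
Qed.

Fact Xi_mx_invertible (phi : Aut (A * B)%type) : Xi_mx phi \in @mx_invertible R.
Proof.
by apply/asboolP; exists (Xi_mx phi^-1%g); rewrite -!Xi_mxM mulgV mulVg Xi_mx1.
Qed.

Definition Xi (phi : Aut (A * B)%type) : GL2 R := MkGL2 (Xi_mx_invertible phi).

End Xi.

Section Pairing.
Variables (k : fieldExtType rat) (F : idealr (ringint k)) (I : osubmod k).

Local Notation FO := (ext_ideal F).
Local Notation hatI := (hat_ideal I).

Fact A_annihilates : annihilates F I (prod_ideal FO I).
Proof.
move=> a x aF xI; apply/asboolP; exists [:: (a : k, x)].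
rewrite big_seq1 /= xI !andbT; split=> //.
by apply/asboolP; exists a.
Qed.

Fact B_annihilates : annihilates F (prod_ideal (inv_ideal FO) hatI) hatI.
Proof.
move=> a x aF /asboolP[s [sP ->]]; rewrite mulr_sumr big_seq.
apply: rpred_sum => p /(allP sP) /andP[/asboolP p1 p2]; rewrite mulrA.
apply: integral_stable p2; rewrite mulrC; apply: p1.
by apply/asboolP; exists a.
Qed.

(* A = I / F I and B = F^-1 hatI / hatI. *)
Definition modA := modquot A_annihilates.
Definition modB := modquot B_annihilates.

HB.instance Definition _ := GRing.Lmodule.on modA.
HB.instance Definition _ := GRing.Lmodule.on modB.

Definition Zrat : {pred rat} := [pred q | q \is a Num.int].

Fact Zrat_zmod : zmod_closed Zrat.
Proof. by split=> [|x y xZ yZ]; rewrite inE ?rpred0 // rpredB. Qed.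

HB.instance Definition _ := GRing.isZmodClosed.Build rat Zrat Zrat_zmod.

Definition invZ (f : int) : {pred rat} :=
  fun q => `[< exists n : int, q = n%:~R / f%:~R >].

Fact invZ_zmod f : zmod_closed (invZ f).
Proof.
split=> [|x y /asboolP[m ->] /asboolP[n ->]]; apply/asboolP.
  by exists 0; rewrite mul0r.
by exists (m - n); rewrite rmorphB mulrBl.
Qed.

HB.instance Definition _ f := GRing.isZmodClosed.Build rat (invZ f) (invZ_zmod f).

(* f is meant to be a generator of the intersection of F with Z. As I hatI is
   the codifferent, the trace below then lies in f^-1 Z, and its class modulo Z
   does not depend on the representatives. *)
Definition delta (f : int) (p p' : modA * modB) : subquot (invZ f) Zrat :=
  let a := qrepr p.1 in let b := qrepr p.2 in
  let a' := qrepr p'.1 in let b' := qrepr p'.2 in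
  qclass (invZ f) Zrat (trace (a * b' - a' * b)).

End Pairing.

(* Main.v *)
(** A class c of O/f acts through (c x, y) |-> Tr(c x y) + Z, so in the bases x, y the
    pairing delta is the determinant form followed by the character
    c |-> Tr(c x y) + Z of O/f.  An automorphism multiplies the determinant form
    by its determinant d, hence it preserves delta iff (d - 1) x y lies in the
    codifferent C.  If e x y is in C, then e I y is in C because I = O x + f I,
    hence e y is in C I^-1 = hat I, and e is in f because y is free: so
    preserving delta means d = 1.

    This needs I and C to be invertible.  A nonzero ideal spanned over Z by the
    coefficients of a polynomial p is inverted following Kronecker and Hurwitz:
    write p g = z with z primitive in Z[X]; by Dedekind's theorem
    (the products of a coefficient of p and a coefficient of g are integral as
    soon as p g has integral coefficients) the coefficients of g lie in the inverse
    ideal, while those of z generate 1.  Finite generation over Z comes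
    from the trace form, C being contained in the span of a dual basis. *)

From HB Require Import structures.
Require Import Defs.
From mathcomp Require Import all_boot all_order all_algebra all_field.
From mathcomp Require Import boolp ring.

Set Implicit Arguments.
Unset Strict Implicit.
Unset Printing Implicit Defensive.

Import GRing.Theory Num.Theory Order.TTheory.
Local Open Scope ring_scope.
Local Open Scope quotient_scope.

(** * Integrality of coefficients of polynomial factors *)

Section PolynomialIntegrality.

Definition integralZ (L : nzRingType) (z : L) := integralOver (intr : int -> L) z.

Section RingClosure.
Variable K : comNzRingType.
Implicit Types u v : K.

Lemma integralZ_nat n : integralZ (n%:R : K). Proof. exact: integral_nat. Qed.
Lemma integralZ0 : integralZ (0 : K). Proof. exact: integral0. Qed.
Lemma integralZ1 : integralZ (1 : K). Proof. exact: integral1. Qed.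
Lemma integralZB u v : integralZ u -> integralZ v -> integralZ (u - v).
Proof. exact: integral_sub. Qed.
Lemma integralZD u v : integralZ u -> integralZ v -> integralZ (u + v).
Proof. exact: integral_add. Qed.
Lemma integralZM u v : integralZ u -> integralZ v -> integralZ (u * v).
Proof. exact: integral_mul. Qed.
Lemma integralZX u n : integralZ u -> integralZ (u ^+ n).
Proof.
by move=> iu; elim: n => [|n IH]; [exact: integralZ1 | rewrite exprS; exact: integralZM].
Qed.

End RingClosure.

Lemma integralZ_fmorph (K L : fieldType) (h : {rmorphism K -> L}) z :
  integralZ (h z) <-> integralZ z.
Proof.
have e (p : {poly int}) : map_poly intr p = map_poly h (map_poly intr p).
  by rewrite -map_poly_comp; apply: eq_map_poly => n /=; rewrite rmorph_int.
split=> -[p mp pz]; exists p => //; last by rewrite e fmorph_root.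
by rewrite e fmorph_root in pz.
Qed.

(* With c the leading coefficient and m + 1 the degree of p, c r is a root of the
   monic polynomial c^m p(X/c), whose coefficients are integral. *)
Lemma lead_coef_root_integral (K : fieldType) (p : {poly K}) r :
  (forall i, integralZ p`_i) -> root p r -> integralZ (lead_coef p * r).
Proof.
move=> pint pr0; have [->|p0] := eqVneq p 0.
  by rewrite lead_coef0 mul0r; apply: integralZ0.
set c := lead_coef p; have [m sp] : exists m, size p = m.+1.
  by exists (size p).-1; rewrite prednK // size_poly_gt0.
case: m sp => [|m] sp.
  move: pr0; rewrite (size1_polyC (eq_leq sp)) rootC => /eqP h.
  by rewrite /c lead_coefE sp h mul0r; apply: integralZ0.
pose P := \poly_(i < m.+2) (if i == m.+1 then 1 else p`_i * c ^+ (m - i)).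
have sP : size P = m.+2 by rewrite size_poly_eq // eqxx oner_eq0.
apply: (@integral_root_monic _ _ _ _ P).
- by rewrite monicE lead_coefE sP coef_poly ltnSn eqxx.
- rewrite rootE horner_poly big_ord_recr /= eqxx mul1r.
  have := pr0; rewrite rootE horner_coef sp big_ord_recr /= => /eqP h.
  have -> : \sum_(i < m.+1) (if i == m.+1 :> nat then 1 else p`_i * c ^+ (m - i))
      * (c * r) ^+ i = c ^+ m * \sum_(i < m.+1) p`_i * r ^+ i.
    rewrite mulr_sumr; apply: eq_bigr => i _.
    rewrite ltn_eqF // exprMn [RHS]mulrCA -mulrA; congr (_ * _).
    by rewrite mulrA -exprD subnK // -ltnS.
  have {1}-> : (c * r) ^+ m.+1 = c ^+ m * (p`_m.+1 * r ^+ m.+1).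
    by rewrite exprMn exprSr -mulrA /c lead_coefE sp.
  by rewrite -mulrDr h mulr0.
- apply/integral_poly => i; rewrite coef_poly; case: ifP => _; last exact: integralZ0.
  case: ifP => _; first exact: integralZ1.
  apply: integralZM (pint i) _.
  have cint : integralZ c by rewrite /c lead_coefE; apply: pint.
  exact: integralZX.
Qed.

(** The hypothesis concerns [q * ('X - r%:P)]. Its leading coefficient c is that of [q], and c r is
    integral because r is one of its roots. Removing the leading term of [q] thus changes the
    product by integral coefficients only, and induction on the size applies. *)
Lemma integral_coef_divXsubC (K : fieldType) (q : {poly K}) r :
  (forall i, integralZ ('X * q - r *: q)`_i) -> forall i, integralZ q`_i.
Proof.
have [n] := ubnP (size q); elim: n q => // n IH q sq pint i.
have [->|q0] := eqVneq q 0; first by rewrite coef0; apply: integralZ0.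
set c := lead_coef q; pose m := (size q).-1.
have sqE : size q = m.+1 by rewrite /m prednK // size_poly_gt0.
have fact : 'X * q - r *: q = q * ('X - r%:P).
  by rewrite mulrBr mulrC (mulrC q r%:P) mul_polyC.
have lc : lead_coef ('X * q - r *: q) = c.
  by rewrite fact lead_coef_Mmonic ?monicXsubC.
have cint : integralZ c by rewrite -lc lead_coefE.
have crint : integralZ (c * r).
  rewrite -lc; apply: lead_coef_root_integral => //.
  by rewrite fact rootM root_XsubC eqxx orbT.
pose q' : {poly K} := q - c *: 'X^m.
have q'int : forall i, integralZ q'`_i.
  apply: IH => [|j].
    rewrite -ltnS; apply: leq_ltn_trans sq; rewrite sqE ltnS.
    apply/leq_sizeP => j; rewrite coefB coefZ coefXn leq_eqVlt => /orP[/eqP <-|mj].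
      by rewrite eqxx mulr1 /c lead_coefE sqE subrr.
    by rewrite gtn_eqF // mulr0 subr0 nth_default // sqE.
  have -> : 'X * q' - r *: q' =
      ('X * q - r *: q) - (c *: 'X^(m.+1) - (c * r) *: 'X^m).
    by rewrite /q' -!mul_polyC polyCM exprS; ring.
  rewrite coefB [X in _ - X]coefB !(coefZ _ 'X^_) !coefXn; apply: integralZB => //.
  by apply: integralZB; apply: integralZM => //; apply: integralZ_nat.
rewrite -[q](subrK (c *: 'X^m)) coefD coefZ coefXn.
by apply: integralZD => //; apply: integralZM => //; apply: integralZ_nat.
Qed.

(** A reducible [p] has a nonconstant divisor of smaller size, whose roots are roots of [p]; so the
    descent ends at an irreducible polynomial, where a root can be adjoined. *)
Lemma exists_root_ext (K : fieldType) (p : {poly K}) : (1 < size p)%N ->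
  exists (L : fieldExtType K) (z : L), root (map_poly (in_alg L) p) z.
Proof.
have [n] := ubnP (size p); elim: n p => // n IH p sp p1.
have [irr|nirr] := pselect (irreducible_poly p).
  by have [L _ [z pz _]] := irredp_FAdjoin irr; exists L, z.
have [q [q1 qp nqp]] : exists q : {poly K}, [/\ size q != 1, q %| p & ~~ (q %= p)].
  apply: contrapT => h; apply: nirr; split => // q q1 qp.
  by apply: contrapT => nqp; apply: h; exists q; split=> //; apply/negP.
have p0 : p != 0 by rewrite -size_poly_gt0 ltnW.
have q0 : q != 0 by apply: contraNneq p0 => q0; move: qp; rewrite q0 dvd0p.
have qlt : (size q < size p)%N.
  by rewrite ltn_neqAle dvdp_leq // andbT (dvdp_size_eqp qp).
have [||L [z qz]] := IH q; first exact: leq_trans qlt _.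
  by rewrite ltn_neqAle eq_sym q1 size_poly_gt0.
exists L, z; have /dvdpP[s ->] := qp.
by rewrite rmorphM rootM qz orbT.
Qed.

(* Dedekind's Prague theorem.  If r is a root of f, possibly in an extension, and
   f = (X - r) q, then q g and r q g both have integral coefficients, and so do
   f_i g_j = q_(i-1) g_j - q_i (r g)_j by induction on the degree of f. *)
Lemma coef_mul_integral (K : fieldType) (f g : {poly K}) :
  (forall i, integralZ (f * g)`_i) -> forall i j, integralZ (f`_i * g`_j).
Proof.
have [n] := ubnP (size f); elim: n K f g => // n IH K f g sf fgint i j.
have [f1|f1] := leqP (size f) 1.
  rewrite (size1_polyC f1) coefC; case: eqP => _; last first.
    by rewrite mul0r; apply: integralZ0.
  by have := fgint j; rewrite {1}(size1_polyC f1) coefCM.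
have [L [r fr]] := exists_root_ext f1.
pose h := in_alg L : {rmorphism K -> L}; pose G := map_poly h g.
have /factor_theorem[q fE] := fr.
have fE' : map_poly h f = 'X * q - r *: q.
  by rewrite [LHS]fE mulrBr mulrC (mulrC q r%:P) mul_polyC.
have q0 : q != 0.
  apply: contraTneq f1 => q0; move/eqP: fE; rewrite q0 mul0r map_poly_eq0.
  by move/eqP->; rewrite size_poly0.
have sq : (size q < n)%N.
  rewrite -ltnS; apply: leq_trans sf; rewrite ltnS.
  by rewrite -(size_map_poly h f) [map_poly h f]fE size_Mmonic ?monicXsubC // size_XsubC addn2.
have FGint l : integralZ ('X * (q * G) - r *: (q * G))`_l.
  rewrite mulrA scalerAl -mulrBl -fE' -rmorphM coef_map.
  by apply/integralZ_fmorph.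
have qGint := integral_coef_divXsubC FGint.
have rint := IH _ q (r *: G) sq.
apply/(integralZ_fmorph h); rewrite rmorphM -!coef_map /= -/G fE'.
rewrite coefB coefXM coefZ mulrBl; apply: integralZB.
  by case: (i == 0); [rewrite mul0r; exact: integralZ0 | exact: IH].
have -> : r * q`_i * G`_j = q`_i * (r *: G)`_j by rewrite coefZ mulrA (mulrC r).
apply: rint => l.
rewrite -scalerAr.
have -> : r *: (q * G) = 'X * (q * G) - ('X * (q * G) - r *: (q * G)).
  by rewrite opprB addrC subrK.
rewrite coefB; apply: integralZB => //.
by rewrite coefXM; case: (l == 0); [exact: integralZ0 | exact: qGint].
Qed.

End PolynomialIntegrality.

Lemma subrACB (V : zmodType) (u v a b : V) : u - v - (a - b) = (u - a) - (v - b).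
Proof. by rewrite !opprB [b - a]addrC addrACA [- v + b]addrC. Qed.

(** * Finitely generated abelian groups *)

Section IntegerSpan.
Variable V : zmodType.
Implicit Types (P : V -> Prop) (s t : seq V).

Definition subgroup P := P 0 /\ forall u v, P u -> P v -> P (u - v).

Lemma subgroupN P u : subgroup P -> P u -> P (- u).
Proof. by move=> [P0 PB] Pu; rewrite -sub0r; apply: PB. Qed.

Lemma subgroupD P u v : subgroup P -> P u -> P v -> P (u + v).
Proof. by move=> gP Pu Pv; rewrite -[v]opprK; apply: (gP.2) => //; apply: subgroupN. Qed.

Lemma subgroupMz P u n : subgroup P -> P u -> P (u *~ n).
Proof.
move=> gP Pu; have Pn m : P (u *+ m).
  by elim: m => [|m IH]; [rewrite mulr0n; exact: gP.1 | rewrite mulrS; exact: subgroupD].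
by case: n => n; [exact: Pn | apply: subgroupN; [|exact: Pn]].
Qed.

(** Integer combinations, encoded by splitting off one generator at a time to suit inductions on the
    list. The generators may satisfy relations. *)
Fixpoint zspan s (v : V) : Prop :=
  if s is e :: s' then exists n : int, zspan s' (v - e *~ n) else v = 0.

Lemma zspan_subgroup s : subgroup (zspan s).
Proof.
elim: s => [|e s [IH0 IHB]] /=; first by split=> // u v -> ->; rewrite subr0.
split; first by exists 0; rewrite mulr0z subr0.
move=> u v [m um] [n vn]; exists (m - n).
have -> : u - v - e *~ (m - n) = (u - e *~ m) - (v - e *~ n).
  by rewrite mulrzBr subrACB.
exact: IHB.
Qed.

Lemma zspan_sub P s v : subgroup P -> (forall e, e \in s -> P e) -> zspan s v -> P v.
Proof.
move=> gP; elim: s v => [|e s IH] v sP /=; first by move->; exact: gP.1.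
move=> [n /IH vn]; rewrite -[v](subrK (e *~ n)); apply: subgroupD => //.
  by apply: vn => w ws; apply: sP; rewrite inE ws orbT.
by apply: subgroupMz => //; apply: sP; rewrite mem_head.
Qed.

End IntegerSpan.

Lemma int_subgroup_principal (J : int -> Prop) : subgroup J ->
  exists2 d : int, J d & forall n, J n -> (d %| n)%Z.
Proof.
move=> gJ; have [[m]|nex] := pselect (exists m : nat, J m.+1); last first.
  exists 0 => [|n Jn]; first exact: gJ.1.
  suff -> : n = 0 by [].
  apply: contrapT => n0; apply: nex; case: n Jn n0 => [[|m]|m] Jn n0 //.
    by exists m.
  by exists m; have := subgroupN gJ Jn; rewrite NegzE opprK.
move=> Jm; have ex : exists m : nat, `[< J m.+1 >] by exists m; apply/asboolP.
case: (ex_minnP ex) => d /asboolP Jd dmin; exists d.+1 => // n Jn.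
(* The remainder of [n] modulo the least positive element of [J] lies in [J] and is smaller, so it
   vanishes. *)
have Jr : J (n %% d.+1)%Z.
  by rewrite /modz mulrC -mulrzz; apply: (gJ.2) => //; apply: subgroupMz.
have := modz_ge0 n (isT : d.+1%:Z != 0); have := ltz_pmod n (isT : 0 < d.+1%:Z).
rewrite dvdzE -/(dvdz _ _); case rE : (n %% d.+1)%Z Jr => [[|r]|//] Jr; last first.
  by rewrite ltz_nat ltnS => rd _; have := dmin r (asboolT Jr); rewrite leqNgt rd.
by move=> _ _; apply/dvdz_mod0P.
Qed.

(** The possible coefficients of the first generator [e] in elements of [P] form a subgroup [J] of
    Z. An element [v0] realizing a generator of [J], together with generators of the part of [P]
    inside [zspan s], spans [P]. *)
Lemma subgroup_zspan_fg (V : zmodType) (P : V -> Prop) (s : seq V) :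
    subgroup P -> (forall v, P v -> zspan s v) ->
  exists2 t : seq V, (forall e, e \in t -> P e) & forall v, P v -> zspan t v.
Proof.
elim: s P => [|e s IH] P gP sP; first by exists [::].
have gs := zspan_subgroup s.
pose J n := exists2 v, P v & zspan s (v - e *~ n).
have [|d [v0 Pv0 v0s] dJ] := @int_subgroup_principal J.
  split; first by exists 0; [exact: gP.1 | rewrite mulr0z subr0; exact: gs.1].
  move=> m n [u Pu us] [v Pv vs]; exists (u - v); first exact: gP.2.
  have -> : u - v - e *~ (m - n) = (u - e *~ m) - (v - e *~ n).
    by rewrite mulrzBr subrACB.
  exact: gs.2.
have [||t tP Pt] := IH (fun v => P v /\ zspan s v).
- split; first by split; [exact: gP.1 | exact: gs.1].
  by move=> u v [Pu us] [Pv vs]; split; [exact: gP.2 | exact: gs.2].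
- by move=> v [].
exists (v0 :: t) => [w|v Pv].
  by rewrite inE => /predU1P[->//|/tP[]].
have [n vn] := sP v Pv; have /dvdzP[q nE] : (d %| n)%Z by apply: dJ; exists v.
exists q; apply: Pt; split; first by apply: (gP.2) => //; apply: subgroupMz.
have -> : v - v0 *~ q = (v - e *~ n) - (v0 - e *~ d) *~ q.
  by rewrite mulrzBl -mulrzA (mulrC d) -nE subrACB subrr subr0.
by apply: (gs.2) => //; apply: subgroupMz.
Qed.

(** * Inversion of ideals *)

Section IdealInversion.
Variable k : fieldExtType rat.

Lemma integral_over_rat (c : k) : integralOver (in_alg k) c.
Proof.
have /polyOver1P[p pE] := minPolyOver 1 c.
exists p; last by rewrite -pE root_minPoly.
by rewrite -(map_monic (in_alg k)) -pE monic_minPoly.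
Qed.

Local Notation toK := (map_poly (in_alg k)).

(** Polynomials are built by sums and products from the variable and constants of k, all integral
    over Q[X]. *)
Lemma integral_over_ratpoly (f : {poly k}) :
  integralOver (toK : {poly rat} -> {poly k}) f.
Proof.
elim/poly_ind: f => [|f c IH]; first exact: integral0.
apply: integral_add.
  apply: integral_mul => //; rewrite -(map_polyX (in_alg k)); exact: integral_id.
have [p mp pc] := integral_over_rat c; exists (map_poly polyC p).
  by rewrite map_monic.
have -> : map_poly toK (map_poly polyC p) = map_poly polyC (toK p).
  by rewrite -!map_poly_comp; apply: eq_map_poly => a /=; rewrite map_polyC.
by rewrite rootE horner_map (rootP pc).
Qed.

(* f is integral over Q[X], and it divides the constant term of any polynomial
   that vanishes at f; this term may be assumed nonzero. *)
Lemma dvdp_ratpoly (f : {poly k}) : f != 0 ->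
  exists2 h : {poly rat}, h != 0 & f %| toK h.
Proof.
move=> f0; have [P mP] := integral_over_ratpoly f.
have {mP} : P != 0 by apply: monic_neq0.
elim/poly_ind: P => [|P c IH]; first by rewrite eqxx.
move=> P0; rewrite rmorphD rmorphM /= map_polyX map_polyC rootE !hornerE.
have [c0|c0] := eqVneq c 0.
  rewrite c0 raddf0 addr0 mulf_eq0 (negPf f0) orbF -rootE; apply: IH.
  by apply: contraNneq P0 => ->; rewrite c0 mul0r add0r.
move=> /eqP/(canRL (addKr _)); rewrite addr0 => h; exists c => //.
by rewrite h -mulNr dvdp_mull.
Qed.

(** Nonzero scalars do not affect divisibility, so denominators and content of a rational multiple
    of [f] can be discarded. *)
Lemma dvdp_primitive (f : {poly k}) : f != 0 ->
  exists2 z : {poly int}, zcontents z = 1 & f %| map_poly intr z.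
Proof.
move=> f0; have [h h0 fh] := dvdp_ratpoly f0.
have [q [a a0 hE]] := rat_poly_scale h.
have q0 : q != 0 by apply: contraNneq h0 => q0; rewrite hE q0 rmorph0 scaler0.
exists (zprimitive q); first by rewrite zcontents_primitive q0.
have zE : toK (map_poly intr (zprimitive q)) = map_poly intr (zprimitive q).
  by rewrite -map_poly_comp; apply: eq_map_poly => n; exact: (rmorph_int (in_alg k)).
have : f %| toK (((zcontents q)%:~R / a%:~R) *: map_poly intr (zprimitive q)).
  by rewrite mulrC -scalerA -map_polyZ /= -zpolyEprim -hE.
rewrite map_polyZ zE dvdpZr // fmorph_eq0 mulf_neq0 // ?invr_eq0 intr_eq0 //.
by rewrite zcontents_eq0.
Qed.

Lemma integralP (x : k) : reflect (integralZ x) (x \in integral k).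
Proof. exact: asboolP. Qed.

Lemma mem_subgroup (M : osubmod k) : subgroup (fun x => x \in M).
Proof. by split=> [|u v uM vM]; rewrite ?rpred0 ?rpredB. Qed.

Lemma zspan_ideal_invertible (M : osubmod k) (s : seq k) :
    (exists2 x, x \in M & x != 0) -> (forall x, x \in M -> zspan s x) ->
  1 \in prod_ideal M (inv_ideal M).
Proof.
move=> [x0 x0M x0_neq0] Ms.
have [t tM Mt] := subgroup_zspan_fg (mem_subgroup M) Ms.
pose f := Poly t; have fM i : f`_i \in M.
  rewrite coef_Poly; have [it|it] := ltnP i (size t); first exact/tM/mem_nth.
  by rewrite nth_default // rpred0.
have f0 : f != 0.
  apply: contraNneq x0_neq0 => f0; apply/eqP.
  apply: (@zspan_sub k (fun v => v = 0) t) (Mt _ x0M).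
    by split=> // u v -> ->; rewrite subr0.
  by move=> _ /(nthP 0)[i _ <-]; rewrite -coef_Poly -/f f0 coef0.
have [z z1 /dvdpP[g zE]] := dvdp_primitive f0.
(* The coefficients of [f] generate [M], and by Dedekind's theorem their products with those of [g]
   are integral, since [f * g] is the integer polynomial [z]. *)
have gM j : g`_j \in inv_ideal M.
  apply/asboolP => y /Mt.
  apply: (@zspan_sub k (fun v => g`_j * v \in integral k)).
    by split=> [|u v uO vO]; rewrite ?mulr0 ?rpred0 // mulrBr rpredB.
  move=> _ /(nthP 0)[i _ <-]; rewrite -(coef_Poly t) -/f; apply/integralP.
  apply: coef_mul_integral => l; rewrite -zE coef_map; exact: integral_id.
(* The integers in the product ideal are multiples of some [d] in it. Every coefficient of [z] is
   one of them, so [d] divides the content 1. *)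
pose J (n : int) := (n%:~R : k) \in prod_ideal M (inv_ideal M).
have [|d Jd dJ] := @int_subgroup_principal J.
  by split=> [|m n Jm Jn]; rewrite /J ?rpred0 // rmorphB rpredB.
have : (d %| zcontents z)%Z.
  rewrite dvdz_contents; apply/polyOverP => l; apply: dJ; rewrite /J.
  have -> : (z`_l)%:~R = (f * g)`_l by rewrite mulrC -zE coef_map.
  rewrite coefM rpred_sum // => i _; apply/asboolP; exists [:: (f`_i, g`_(l - i))].
  by rewrite /= fM gM big_seq1.
rewrite z1 dvdz1 => d1; have := mem_subgroup (prod_ideal M (inv_ideal M)).
move=> /subgroupN/(_ Jd); move: Jd; rewrite /J -rmorphN.
by case: d d1 {dJ} => -[|[|m]].
Qed.

(** A primitive integer multiple of X - a has [a] as a root, and its leading coefficient serves as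
    [n]. *)
Lemma exists_integral_multiple (a : k) : exists2 n : int, n != 0 & n%:~R * a \in integral k.
Proof.
have [a0|a0] := eqVneq a 0; first by exists 1 => //; rewrite a0 mulr0 rpred0.
have [|z z1 /dvdpP[g zE]] := @dvdp_primitive ('X - a%:P); first by rewrite polyXsubC_eq0.
exists (lead_coef z).
  by rewrite lead_coef_eq0; apply/eqP => z0; move: z1; rewrite z0 zcontents0.
apply/integralP.
have -> : (lead_coef z)%:~R = lead_coef (map_poly (intr : int -> k) z).
  rewrite lead_coef_map_inj // => m n mn; apply/(@intr_inj rat)/(fmorph_inj (in_alg k)).
  by rewrite !rmorph_int.
apply: lead_coef_root_integral => [i|]; first by rewrite coef_map; exact: integral_id.
by rewrite zE rootM root_XsubC eqxx orbT.
Qed.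

End IdealInversion.

(** * The codifferent *)

Section Trace.
Import passmx.
Variable k : fieldExtType rat.
Local Notation n := (\dim {:k}).
Local Notation b := (vbasis {:k}).

Definition mulmat (a : k) : 'M[rat]_n := mxof b b (amull a).

Fact mulmat_linear : linear mulmat.
Proof. by move=> c u v; rewrite /mulmat !linearP. Qed.

HB.instance Definition _ :=
  GRing.isLinear.Build rat k 'M[rat]_n _ mulmat mulmat_linear.

Lemma mulmatM u v : mulmat (u * v) = mulmat u *m mulmat v.
Proof.
rewrite /mulmat -(mxof_comp b b (vbasisP {:k})).
by congr mxof; apply/lfunP => w; rewrite comp_lfunE !lfunE /= mulrA (mulrC v).
Qed.

Lemma mulmat1 : mulmat 1 = 1%:M.
Proof.
rewrite /mulmat -(mxof1 (basis_free (vbasisP {:k}))).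
by congr mxof; apply/lfunP => w; rewrite !lfunE /= mul1r.
Qed.

Lemma traceZ c (a : k) : trace (c *: a) = c * trace a.
Proof. by rewrite -[LHS]/(\tr (mulmat _)) linearZ mxtraceZ. Qed.

(** For nonzero [z], taking the inverse of [z] as [w] gives the trace of 1, which is the degree of k
    and so nonzero in Q. *)
Lemma trace_nondegenerate (z : k) : (forall w, trace (z * w) = 0) -> z = 0.
Proof.
move=> zT; apply/eqP; apply: contraT => z0; have := zT z^-1.
rewrite divff // -[trace _]/(\tr (mulmat 1)) mulmat1 mxtrace1 => /eqP.
by rewrite pnatr_eq0 -leqn0 leqNgt adim_gt0.
Qed.

(** On an eigenvector [v] for [l], the matrix of p(a) acts as p(l). Hence a monic integer polynomial
    vanishing at [a] also vanishes at [l]. *)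
Lemma eigenvalue_mulmat_Aint (a : k) (l : algC) :
  a \in integral k -> eigenvalue (map_mx ratr (mulmat a)) l -> l \in Aint.
Proof.
move=> /integralP[p mp pa] /eigenvalueP[v vM v0].
have vX i : v *m map_mx ratr (mulmat (a ^+ i)) = l ^+ i *: v.
  elim: i => [|i IH]; first by rewrite expr0 mulmat1 map_mx1 mulmx1 scale1r.
  by rewrite exprSr mulmatM map_mxM mulmxA IH -scalemxAl vM scalerA exprSr.
apply: (@root_monic_Aint (map_poly intr p)); last 2 first.
- exact: monic_map.
- by apply/polyOverP => i; rewrite coef_map; apply: intr_int.
have sp : size (map_poly (intr : int -> k) p) = size p.
  by rewrite size_map_poly_id0 // (monicP mp) oner_eq0.
have sp' : size (map_poly (intr : int -> algC) p) = size p.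
  by rewrite size_map_poly_id0 // (monicP mp) oner_eq0.
rewrite rootE horner_coef sp'.
suff : (\sum_(i < size p) (map_poly intr p)`_i * l ^+ i) *: v = 0.
  by move/eqP; rewrite scaler_eq0 (negPf v0) orbF.
rewrite scaler_suml.
have := congr1 (fun m => v *m map_mx (ratr : rat -> algC) m) (congr1 mulmat (rootP pa)).
rewrite raddf0 map_mx0 mulmx0 horner_coef sp raddf_sum raddf_sum mulmx_sumr => E.
rewrite -[RHS]E {E}.
apply: eq_bigr => i _; rewrite !coef_map /=.
by rewrite !mulrzl raddfMz raddfMz -scalerMzl -vX; apply/esym/(raddfMz (mulmx v)).
Qed.

(** The trace is the sum of the complex eigenvalues, which are algebraic integers; a rational
    algebraic integer is an integer. *)
Lemma trace_integral (a : k) : a \in integral k -> trace a \is a Num.int.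
Proof.
move=> aO; pose M := map_mx (ratr : rat -> algC) (mulmat a).
have n_gt0 : (0 < n)%N by rewrite adim_gt0.
have [r rE] := closed_field_poly_normal (char_poly M).
rewrite (monicP (char_poly_monic M)) scale1r in rE.
have sr : size r = n.
  by apply: succn_inj; rewrite -(size_prod_XsubC _ id) -rE size_char_poly.
have trE : ratr (trace a) = \sum_(z <- r) z.
  rewrite -[trace a]/(\tr (mulmat a)) -trace_map_mx -[LHS]opprK -char_poly_trace //.
  by rewrite -/M rE -sr coefPn_prod_XsubC ?opprK // sr -lt0n.
have /intrP[m mE] : (ratr (trace a) : algC) \is a Num.int.
  apply: Cint_rat_Aint; first exact: Crat_rat.
  rewrite trE big_seq; apply: rpred_sum => z zr.
  apply: (eigenvalue_mulmat_Aint aO); rewrite eigenvalue_root_char -/M rE.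
  by rewrite root_prod_XsubC.
apply/intrP; exists m; apply: (fmorph_inj (ratr : {rmorphism rat -> algC})).
by rewrite /= mE rmorph_int.
Qed.

Lemma zspan_map_sum (J : eqType) (r : seq J) (w : J -> k) (m : J -> int) :
  zspan (map w r) (\sum_(j <- r) w j *~ m j).
Proof.
elim: r => [|j r IH] /=; first by rewrite big_nil.
by exists (m j); rewrite big_cons addrAC subrr add0r.
Qed.

Lemma codifferent_zspan : exists s : seq k, forall z : k, z \in @codifferent k -> zspan s z.
Proof.
pose G : 'M[rat]_n := \matrix_(i, j) trace (b`_i * b`_j).
have GE z : rVof b z *m G = \row_j trace (z * b`_j).
  apply/rowP => j; rewrite !mxE {2}(coord_vbasis (memvf z)) mulr_suml raddf_sum.
  by apply: eq_bigr => i _; rewrite !mxE -traceZ scalerAl.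
have uG : G \in unitmx.
  (* A row vector killed by the Gram matrix [G] is the coordinate vector of an element orthogonal to
     all of k for the trace form. *)
  rewrite -row_free_unit; apply: inj_row_free => u uG0.
  rewrite -[u](vecofK (vbasisP {:k})); apply/eqP; rewrite rVof_eq0 ?vbasisP //.
  apply/eqP/trace_nondegenerate => w; set z := vecof _ _.
  have := GE z; rewrite /z vecofK ?vbasisP // uG0 => /rowP zb.
  rewrite (coord_vbasis (memvf w)) mulr_sumr raddf_sum big1 // => j _.
  by rewrite -scalerAr [LHS]traceZ; have := zb j; rewrite !mxE => <-; rewrite mulr0.
have /choice[N NP] : forall j : 'I_n, exists m : int,
    m != 0 /\ m%:~R * b`_j \in integral k.
  by move=> j; have [m m0 mb] := exists_integral_multiple b`_j; exists m.
(* The rows of the inverse Gram matrix give the dual basis. The coordinates of [z] in it are the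
   traces of [z * b_j], which have denominator [N j] because [N j] times [b_j] is integral. *)
pose w j := (N j)%:~R^-1 *: vecof b (row j (invmx G)).
exists (map w (enum 'I_n)) => z /asboolP zC.
have /choice[m mE] : forall j : 'I_n, exists m : int, trace (z * b`_j) = (N j)%:~R^-1 * m%:~R.
  move=> j; have [Nj0 Njb] := NP j; have /intrP[m mE] := zC _ Njb; exists m.
  by rewrite -mE mulrCA mulrzl -scaler_int traceZ mulKf // intr_eq0.
suff -> : z = \sum_(j <- enum 'I_n) w j *~ m j by apply: zspan_map_sum.
rewrite big_enum /= -[LHS](rVofK (vbasisP {:k})) -[rVof _ _](mulmxK uG) GE.
rewrite mulmx_sum_row linear_sum; apply: eq_bigr => j _.
by rewrite linearZ /= mxE mE /w -scaler_int scalerA mulrC.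
Qed.

End Trace.

(** * Invertibility of fractional ideals and duality for the trace *)

Section InvertibleIdeals.
Variable k : fieldExtType rat.
Implicit Types M N I : osubmod k.

Lemma prod_ideal_sub M N (P : k -> Prop) z : subgroup P ->
  (forall u v, u \in M -> v \in N -> P (u * v)) -> z \in prod_ideal M N -> P z.
Proof.
move=> gP PMN /asboolP[s [sP ->]]; elim: s sP => [|p s IH] /=.
  by rewrite big_nil => _; exact: gP.1.
by move=> /andP[/andP[p1 p2] sP]; rewrite big_cons; apply: subgroupD => //; auto.
Qed.

Lemma mem_prod_ideal M N u v : u \in M -> v \in N -> u * v \in prod_ideal M N.
Proof.
by move=> uM vN; apply/asboolP; exists [:: (u, v)]; rewrite /= uM vN big_seq1.
Qed.

Lemma mulr_subgroup M w : subgroup (fun z => z * w \in M).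
Proof. by split=> [|u v uM vM]; rewrite ?mul0r ?rpred0 // mulrBl rpredB. Qed.

(** Multiply by [x] an expression of 1 as a sum of products [u * v]: each [v * x] is integral, so
    each term stays in [M]. For the codifferent this shows that the inverse of the different is the
    codifferent again. *)
Lemma inv_inv_ideal_sub M x :
  1 \in prod_ideal M (inv_ideal M) -> x \in inv_ideal (inv_ideal M) -> x \in M.
Proof.
move=> M1 /asboolP xM; rewrite -[x]mul1r.
apply: (prod_ideal_sub (mulr_subgroup M x)) M1 => u v uM vM.
by rewrite -mulrA mulrC; apply: integral_stable uM; rewrite mulrC xM.
Qed.

Lemma integral_codifferent a : a \in integral k -> a \in @codifferent k.
Proof. by move=> aO; apply/asboolP => y yO; rewrite trace_integral // rpredM. Qed.

Lemma codifferent_trace z : z \in @codifferent k -> trace z \is a Num.int.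
Proof. by move=> /asboolP/(_ 1 (rpred1 _)); rewrite mulr1. Qed.

Lemma codifferent_invertible : 1 \in prod_ideal (@codifferent k) (inv_ideal (@codifferent k)).
Proof.
have [s sC] := codifferent_zspan k; apply: zspan_ideal_invertible sC.
by exists 1; [exact/integral_codifferent/rpred1 | exact: oner_neq0].
Qed.

(** Since [d] times [I] consists of integral elements, which lie in the codifferent, [I] is
    contained in a finitely generated group. *)
Lemma fractional_ideal_invertible I :
  fractional_ideal I -> 1 \in prod_ideal I (inv_ideal I).
Proof.
move=> [I0 [d dO [d0 dI]]]; have [s sC] := codifferent_zspan k.
apply: (@zspan_ideal_invertible _ _ (map ( *%R d^-1) s)) => // x xI.
rewrite -[x](mulKf d0); move: (d * x) (sC _ (integral_codifferent (dI x xI))).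
elim: s {sC} => [|e s IH] z /=; first by move->; rewrite mulr0.
by move=> [n /IH]; rewrite mulrBr mulrzAr; exists n.
Qed.

Lemma hat_ideal_codifferent I u v :
  u \in I -> v \in hat_ideal I -> u * v \in @codifferent k.
Proof.
move=> uI; rewrite mulrC; apply: prod_ideal_sub (mulr_subgroup _ u) _ => s t sD /asboolP tI.
rewrite -mulrA mulrC; apply: integral_stable; first exact: tI.
exact: inv_inv_ideal_sub codifferent_invertible sD.
Qed.

(** With 1 a sum of products [u * v], [z] is the sum of the [(u * z) * v], where [u * z] is in the
    codifferent, hence in the inverse of the different. *)
Lemma mem_hat_ideal I z : 1 \in prod_ideal I (inv_ideal I) ->
  (forall u, u \in I -> u * z \in @codifferent k) -> z \in hat_ideal I.
Proof.
move=> I1 zI; rewrite -[z]mul1r.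
apply: (prod_ideal_sub (mulr_subgroup (hat_ideal I) z)) I1 => u v uI vI.
rewrite mulrAC; apply: mem_prod_ideal => //; apply/asboolP => w /asboolP wD.
by rewrite mulrC; apply: wD; apply: zI.
Qed.

End InvertibleIdeals.

(** * Representatives of classes in the quotient modules *)

Section QuotientRepresentatives.

(** The memberships in [M] keep [insubd] away from its default value 0. *)
Lemma qclass_eq (V : zmodType) (M N : zmodClosed V) u v : u \in M -> v \in M ->
  qclass M N u = qclass M N v <-> u - v \in N.
Proof.
move=> uM vM; rewrite /qclass.
have E : (insubd 0 u - insubd 0 v : subgrp M) \in @subgrp_in V M N = (u - v \in N).
  by rewrite [LHS]/(_ \in N) /= !insubdK.
by rewrite -E Quotient.idealrBE; split=> [->|/eqP].
Qed.

Variables (k : fieldExtType rat) (F : idealr (ringint k)) (M N : osubmod k).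
Hypothesis FMN : annihilates F M N.
Implicit Types (q : modquot FMN) (c : {ideal_quot F}).

Lemma qrepr_scale c q : qrepr (c *: q) - (repr c : k) * qrepr q \in N.
Proof. by rewrite -sub_scaleE; apply: qpi_eq; rewrite reprK. Qed.

Lemma qrepr_eq0 q : qrepr q \in N -> q = 0.
Proof.
move=> qN; rewrite -[q]reprK -[RHS](raddf0 \pi_(subquot M N)).
by apply: eq_qpi; rewrite subr0.
Qed.

Lemma exists_qrepr u : u \in M -> exists q, u - qrepr q \in N.
Proof.
move=> uM; exists (\pi_(subquot M N) (Subgrp uM)).
by apply: (@qpi_eq k M N (Subgrp uM)); rewrite reprK.
Qed.

Lemma repr_idealP (a : ringint k) c : \pi_{ideal_quot F} a = c <-> a - repr c \in F.
Proof. by rewrite Quotient.idealrBE reprK; split=> [->|/eqP]. Qed.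

End QuotientRepresentatives.

(** * The pairing in coordinates *)

Section PairingInCoordinates.
Variables (k : fieldExtType rat) (I : osubmod k) (F : idealr (ringint k)).
Hypotheses (I_fractional : fractional_ideal I).
Hypothesis (F_nonzero : exists2 a, a \in F & a != 0).
Variable f : int.
Hypothesis F_capZ : forall n : int, (n%:~R \in F) = (f %| n)%Z.
Local Notation R := {ideal_quot F}.
Local Notation FO := (ext_ideal F).
Local Notation hatI := (hat_ideal I).
Local Notation C := (@codifferent k).
Local Notation FI := (prod_ideal FO I).
Local Notation FhatI := (prod_ideal (inv_ideal FO) hatI).

Lemma ringint_val_int (n : int) : (n%:~R : ringint k) = n%:~R :> k.
Proof. exact: (rmorph_int (val : ringint k -> k)). Qed.

(** If [n / a] is integral for a nonzero [a] in [F], then [n] is a multiple of [a], hence a nonzero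
    integer in [F]. *)
Lemma conductor_neq0 : f != 0.
Proof.
have [a aF a0] := F_nonzero; have [n n0 nO] := exists_integral_multiple (a : k)^-1.
have a0' : (a : k) != 0 by apply: contraNneq a0 => a0; apply/eqP/val_inj.
apply: contraNneq n0 => f0; rewrite -dvd0z -f0 -F_capZ.
have -> : n%:~R = Ringint nO * a :> ringint k.
  by apply: val_inj; rewrite /= ringint_val_int mulfVK.
exact: idealMr.
Qed.

Lemma conductor_mem : f%:~R \in F.
Proof. by rewrite F_capZ. Qed.

Lemma prod_FI_FhatI u v : u \in FI -> v \in FhatI -> u * v \in C.
Proof.
move=> uFI vFI; apply: (prod_ideal_sub (mulr_subgroup C v)) uFI => a i aF iI.
rewrite mulrC; apply: (prod_ideal_sub (mulr_subgroup C (a * i))) vFI => b h /asboolP bF hI.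
have -> : b * h * (a * i) = (b * a) * (i * h) by ring.
by apply: integral_stable; [exact: bF | exact: hat_ideal_codifferent iI hI].
Qed.

(** Multiplying [u] by [f] moves it into [F I], whose products with elements of the second module
    have integer trace. *)
Lemma trace_invZ u v : u \in I -> v \in FhatI -> trace (u * v) \in invZ f.
Proof.
move=> uI vF; have fuI : f%:~R * u \in FI.
  by rewrite -ringint_val_int; exact: (A_annihilates conductor_mem uI).
have /codifferent_trace/intrP[n nE] := prod_FI_FhatI fuI vF.
apply/asboolP; exists n; rewrite -nE -mulrA mulrzl -scaler_int traceZ.
rewrite [_ * trace _]mulrC mulfK //.
by rewrite intr_eq0 conductor_neq0.
Qed.

Lemma mul_congr_codifferent u u' v v' : u' \in I -> v \in FhatI ->
  u - u' \in FI -> v - v' \in hatI -> u * v - u' * v' \in C.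
Proof.
move=> u'I vF uu vv; have -> : u * v - u' * v' = (u - u') * v + u' * (v - v') by ring.
by apply: rpredD; [exact: prod_FI_FhatI | exact: hat_ideal_codifferent u'I vv].
Qed.

Variables (x : modA F I) (y : modB F I).
Hypotheses (x_basis : is_basis x) (y_basis : is_basis y).
Local Notation X := (qrepr x).
Local Notation Y := (qrepr y).

Let XI : X \in I. Proof. exact: valP. Qed.
Let YF : Y \in FhatI. Proof. exact: valP. Qed.

Lemma mul_ideal_basis (a : ringint k) : a \in F -> (a : k) * (X * Y) \in C.
Proof. by move=> aF; rewrite mulrA prod_FI_FhatI //; exact: (A_annihilates aF). Qed.

Definition delta_coord (c : R) : subquot (invZ f) Zrat :=
  qclass (invZ f) Zrat (trace ((repr c : k) * (X * Y))).

Lemma coord_trace_invZ (a : ringint k) : trace ((a : k) * (X * Y)) \in invZ f.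
Proof.
by rewrite mulrA; apply: trace_invZ => //; apply: integral_stable XI; exact: valP.
Qed.

Lemma delta_coordE (a b a' b' : R) :
  delta f (a *: x, b *: y) (a' *: x, b' *: y) = delta_coord (a * b' - a' * b).
Proof.
have scaleC (c d : R) : qrepr (c *: x) * qrepr (d *: y)
    - ((repr c * repr d : ringint k) : k) * (X * Y) \in C.
  have -> : ((repr c * repr d : ringint k) : k) * (X * Y)
      = ((repr c : k) * X) * ((repr d : k) * Y) by rewrite /=; ring.
  apply: mul_congr_codifferent; [|exact: valP|exact: qrepr_scale|exact: qrepr_scale].
  by apply: integral_stable XI; exact: valP.
have scale_invZ (c d : R) : trace (qrepr (c *: x) * qrepr (d *: y)) \in invZ f.
  by apply: trace_invZ; exact: valP.
apply/qclass_eq; [| exact: coord_trace_invZ |].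
  by rewrite raddfB; apply: rpredB; exact: scale_invZ.
rewrite -(raddfB (@trace k)); apply: codifferent_trace; set g := repr (_ - _).
(* The chosen representative [g] of the determinant need not be the determinant of the chosen
   representatives; the difference lies in [F] and is invisible to the trace modulo Z. *)
pose g0 : ringint k := repr a * repr b' - repr a' * repr b.
have gF : g0 - g \in F.
  by apply/repr_idealP; rewrite /g0 rmorphB !rmorphM /= !reprK.
have := rpredD (rpredB (scaleC a b') (scaleC a' b)) (mul_ideal_basis gF).
congr (_ \in C); rewrite /g0 /=; ring.
Qed.

Lemma basis_nondegenerate (e : ringint k) : (e : k) * (X * Y) \in C -> e \in F.
Proof.
move=> eC; have eY : (e : k) * Y \in hatI.
  apply: mem_hat_ideal; first exact: fractional_ideal_invertible.
  (* As [x] generates the first module, [u] is a multiple of [X] up to [F I]. The multiple is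
     handled by the hypothesis on [e], the remainder by pairing [F I] with the second module. *)
  move=> u uI; have [q uq] := exists_qrepr (@A_annihilates k F I) uI.
  have [c qE] := x_basis.1 q.
  have qc : qrepr q - (repr c : k) * X \in FI by rewrite qE; exact: qrepr_scale.
  have -> : u * ((e : k) * Y) =
      (u - (repr c : k) * X) * ((e : k) * Y) + (repr c : k) * ((e : k) * (X * Y)) by ring.
  apply: rpredD; last by apply: integral_stable eC; exact: valP.
  apply: prod_FI_FhatI; last by apply: integral_stable YF; exact: valP.
  by rewrite -(subrK (qrepr q) u) -addrA; apply: rpredD.
(* Since [e Y] represents zero, the class of [e] kills [y], and freeness of [y] puts [e] in [F]. *)
have : (\pi_R e : R) *: y = 0.
  apply: qrepr_eq0; set c := \pi_R e; have ec : e - repr c \in F by apply/repr_idealP.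
  have -> : qrepr (c *: y) = (qrepr (c *: y) - (repr c : k) * Y)
     + ((e : k) * Y - ((e - repr c : ringint k) : k) * Y) by rewrite /=; ring.
  by rewrite rpredD ?qrepr_scale // rpredB // (B_annihilates ec).
move/(y_basis.2) => e0; rewrite -[e]subr0 Quotient.idealrBE; apply/eqP.
by rewrite rmorph0.
Qed.

End PairingInCoordinates.

(** * Automorphisms as matrices *)

Section AutomorphismsAsMatrices.
Variables (R : comNzRingType) (A B : lmodType R) (x : A) (y : B).
Hypotheses (x_basis : is_basis x) (y_basis : is_basis y).
Implicit Types M N : 'M[R]_2.

Lemma pair_coordE (p : A * B) : p = (coord1 x p.1 *: x, coord1 y p.2 *: y).
Proof. by rewrite -!coord1E //; case: p. Qed.

Lemma Xi_mx_apply (phi : Aut (A * B)%type) a b :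
  phi (a *: x, b *: y) =
    ((Xi_mx x y phi 0 0 * a + Xi_mx x y phi 0 1 * b) *: x,
     (Xi_mx x y phi 1 0 * a + Xi_mx x y phi 1 1 * b) *: y).
Proof.
have -> : (a *: x, b *: y) = a *: ((x, 0) : A * B) + b *: ((0, y) : A * B).
  by congr pair; rewrite /= scaler0 ?addr0 ?add0r.
rewrite linearD !linearZ /=; have [-> ->] := Xi_mxE x_basis y_basis phi.
by congr pair; rewrite /= !scalerA -scalerDl (mulrC a) (mulrC b).
Qed.

Lemma Xi_mx_inj (phi psi : Aut (A * B)%type) : Xi_mx x y phi = Xi_mx x y psi -> phi = psi.
Proof.
by move=> e; apply: Aut_eqP => p; rewrite (pair_coordE p) !Xi_mx_apply e.
Qed.

(** Used to build the inverse of [Xi]: the matrix acts on the coordinate column of a pair. *)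
Definition mx_act M (p : A * B) : A * B :=
  ((M 0 0 * coord1 x p.1 + M 0 1 * coord1 y p.2) *: x,
   (M 1 0 * coord1 x p.1 + M 1 1 * coord1 y p.2) *: y).

Lemma coord1Z (V : lmodType R) (e : V) c : is_basis e -> coord1 e (c *: e) = c.
Proof. by move=> eb; apply: (coord1_unique eb); rewrite -coord1E. Qed.

Lemma coord1_linear (V : lmodType R) (e : V) : is_basis e -> scalar (coord1 e).
Proof.
move=> eb c u v; apply: (coord1_unique eb).
by rewrite -coord1E // scalerDl -scalerA -!coord1E.
Qed.

Lemma mx_act_linear M : linear (mx_act M).
Proof.
move=> c u v; rewrite /mx_act /= !coord1_linear //.
by congr pair; rewrite /= scalerA -scalerDl; congr (_ *: _); ring.
Qed.

Lemma mx_actM M N p : mx_act (M *m N) p = mx_act M (mx_act N p).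
Proof.
rewrite /mx_act /= !coord1Z // !mxE !big_ord_recl !big_ord0 !addr0.
have -> : lift ord0 ord0 = 1 :> 'I_2 by apply: val_inj.
by congr pair; congr (_ *: _); ring.
Qed.

Lemma mx_act1 p : mx_act 1%:M p = p.
Proof. by rewrite /mx_act !mxE /= !mul1r !mul0r addr0 add0r -pair_coordE. Qed.

Lemma mx_act_bij (g : GL2 R) : bijective (mx_act g).
Proof.
have [gV Vg] := GL2_inv_mxP g.
by exists (mx_act (GL2_inv_mx g)) => p; rewrite -mx_actM ?gV ?Vg mx_act1.
Qed.

Definition Aut_of_mx (g : GL2 R) : Aut (A * B)%type :=
  MkAut (@mx_act_linear g) (mx_act_bij g).

Lemma Aut_of_mxK (g : GL2 R) : Xi x_basis y_basis (Aut_of_mx g) = g.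
Proof.
have c0 (V : lmodType R) (e : V) : is_basis e -> coord1 e 0 = 0.
  by move=> eb; rewrite -[X in coord1 _ X](scale0r e) coord1Z.
have c1 (V : lmodType R) (e : V) : is_basis e -> coord1 e e = 1.
  by move=> eb; rewrite -[X in coord1 _ X](scale1r e) coord1Z.
apply: val_inj; apply: Xi_mx_unique => //=; rewrite /mx_act /= !c0 // !c1 //.
  by rewrite !mulr1 !mulr0 !addr0.
by rewrite !mulr1 !mulr0 !add0r.
Qed.

End AutomorphismsAsMatrices.

(** * The symplectic condition as determinant one *)

Lemma det_mx22 (R : comNzRingType) (M : 'M[R]_2) :
  \det M = M 0 0 * M 1 1 - M 0 1 * M 1 0.
Proof.
rewrite (expand_det_row _ 0) !big_ord_recl big_ord0 addr0 /cofactor !det_mx11 !mxE /=.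
have -> : lift ord0 ord0 = 1 :> 'I_2 by apply: val_inj.
have -> : lift 1 0 = 0 :> 'I_2 by apply: val_inj.
by rewrite /= !expr0 expr1 mul1r mulN1r mulrN.
Qed.

(** In coordinates [phi] multiplies the determinant form by its determinant [d]. If it preserves
    [delta], nondegeneracy of the character [delta_coord] forces [d - 1] to vanish modulo [F]. *)
Lemma Sp_det1 (k : fieldExtType rat) (I : osubmod k) (F : idealr (ringint k)) (f : int)
    (x : modA F I) (y : modB F I) (x_basis : is_basis x) (y_basis : is_basis y)
    (phi : Aut (modA F I * modB F I)%type) :
    fractional_ideal I -> (exists2 a, a \in F & a != 0) ->
    (forall n : int, (n%:~R \in F) = (f %| n)%Z) ->
  reflect (\det (Xi_mx x y phi) = 1) (phi \in Sp_pred (@delta k F I f)).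
Proof.
move=> I_frac F_neq0 F_capZ.
have phiE a b a' b' : delta f (phi (a *: x, b *: y)) (phi (a' *: x, b' *: y)) =
    delta_coord f x y (\det (Xi_mx x y phi) * (a * b' - a' * b)).
  rewrite !Xi_mx_apply // delta_coordE // det_mx22; congr delta_coord; ring.
apply: (iffP (asboolP _)) => [phiP|det1 p q]; last first.
  by rewrite (pair_coordE x_basis y_basis p) (pair_coordE x_basis y_basis q)
     phiE det1 mul1r delta_coordE.
set d := \det _; apply/eqP; rewrite -subr_eq0 -[d]reprK -(rmorph1 \pi_{ideal_quot F}) -rmorphB.
rewrite -(rmorph0 \pi_{ideal_quot F}) -Quotient.idealrBE subr0.
apply: (basis_nondegenerate I_frac x_basis y_basis); apply/asboolP => g gO.
(* The vectors (c x, 0) and (0, y) have determinant form [c], so the test pair realizes an arbitrary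
   class of O/F. *)
pose c := \pi_{ideal_quot F} (Ringint gO).
have := phiP (c *: x, 0 *: y) (0 *: x, 1 *: y).
rewrite phiE delta_coordE // !mulr1 mul0r subr0.
have chiZ := coord_trace_invZ F_neq0 F_capZ x y.
move/qclass_eq => /(_ (chiZ _) (chiZ _)).
rewrite -/d -(raddfB (@trace k)) => /= dcZ.
(* The invariance of [delta] speaks of the chosen representatives of [d * c] and [c]; [h] measures
   their discrepancy from [(d - 1) * g] and lies in [F]. *)
pose h : ringint k := (repr d - 1) * Ringint gO - (repr (d * c) - repr c).
have hF : h \in F.
  rewrite -[h]subr0 Quotient.idealrBE rmorphB rmorphM !rmorphB rmorph1 /= !reprK rmorph0.
  by apply/eqP; rewrite -/c; ring.
have -> : ((repr d - 1 : ringint k) : k) * (qrepr x * qrepr y) * g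
    = (h : k) * (qrepr x * qrepr y)
      + ((repr (d * c) : k) * (qrepr x * qrepr y) - (repr c : k) * (qrepr x * qrepr y)).
  by rewrite /h /=; ring.
by rewrite raddfD; apply: rpredD dcZ; apply/codifferent_trace/mul_ideal_basis.
Qed.

Theorem theorem7p1 (k : fieldExtType rat)
    (I : osubmod k) (I_fractional : fractional_ideal I)
    (F : idealr (ringint k)) (F_nonzero : exists2 a, a \in F & a != 0)
    (f : int) (F_capZ : forall n : int, (n%:~R \in F) = (f %| n)%Z)
    (x : modA F I) (y : modB F I)
    (x_basis : is_basis x) (y_basis : is_basis y) :
  exists psi : {multiplicative Sp (@delta k F I f) -> SL2 {ideal_quot F}},
    bijective psi /\
    forall alpha, SL2_val (psi alpha) = Xi x_basis y_basis (Sp_val alpha).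
Proof.
have SpP phi := @Sp_det1 k I F f x y x_basis y_basis phi I_fractional F_nonzero F_capZ.
have psiP (alpha : Sp (@delta k F I f)) : 
    Xi x_basis y_basis (Sp_val alpha) \in @SL2_pred {ideal_quot F}.
  by apply/eqP/SpP; exact: valP.
pose psi alpha := MkSL2 (psiP alpha).
have psiM : {morph psi : a b / (a * b)%g}.
  by move=> a b; do 2 apply: val_inj; apply: Xi_mxM.
pose psi' := HB.pack_for {multiplicative Sp (@delta k F I f) -> SL2 {ideal_quot F}} psi
  (isMultiplicative.Build _ _ psi psiM).
exists psi'; split=> //.
(* A matrix of determinant one comes from an automorphism, which is symplectic by the determinant
   criterion. *)
have psi_onto (g : SL2 {ideal_quot F}) : exists alpha, psi alpha = g.
  pose phi := Aut_of_mx x_basis y_basis (SL2_val g).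
  have phiE : Xi x_basis y_basis phi = SL2_val g by exact: Aut_of_mxK.
  have phiSp : phi \in Sp_pred (@delta k F I f).
    apply/SpP; rewrite -[Xi_mx _ _ _]/(GL2_val (Xi x_basis y_basis phi)) phiE.
    exact: (eqP (valP g)).
  by exists (MkSp phiSp); apply: val_inj.
have /choice[h hK] := psi_onto.
have psi_inj : injective psi.
  move=> a b e; apply/val_inj/(Xi_mx_inj x_basis y_basis).
  exact: (congr1 (fun g : SL2 _ => GL2_val (SL2_val g)) e).
by exists h => // a; apply: psi_inj; rewrite hK.
Qed.
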